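(* For every integer $l\geq 1$ the Sieradski group $S(2,6l)$ is a LOG group: it has the LOG presentation with generators $a_i,b_i$ ($0\leq i<2l$) and relations, for each $0\leq j<l$, \[a_{2j+1}=b_{2j}^{-1}a_{2j}b_{2j},\qquad a_{2j+1}=b_{2j+1}^{-1}a_{2j+2}b_{2j+1},\] \[b_{2j}=a_{2j+1}^{-1}b_{2j+1}a_{2j+1},\qquad b_{2j+2}=a_{2j+2}^{-1}b_{2j+1}a_{2j+2},\] where the subscripts of the $a$ and $b$ generators are taken modulo $2l$; and the corresponding LOG has two components.
   Context: The Sieradski group $S(2,n)$ is the group with presentation $\langle x_0,\ldots,x_{n-1}\mid x_ix_{i+2}x_{i+1}^{-1}\ (0\leq i<n)\rangle$, subscripts taken modulo $n$. A Labelled Oriented Graph (LOG) consists of a finite graph, possibly with loops and multiple edges, with vertex set $V$ and edge set $E$, together with three maps $\iota,\tau,\lambda:E\to V$ (initial vertex, terminal vertex, and label). It determines the LOG presentation $\langle V\mid \tau(e)^{-1}\lambda(e)^{-1}\iota(e)\lambda(e)\ (e\in E)\rangle$; thus a relation $\tau=\lambda^{-1}\iota\lambda$ with $\tau,\lambda,\iota\in V$ corresponds to an edge from $\iota$ to $\tau$ labelled $\lambda$. A LOG group is a group having a LOG presentation. The components of the LOG are the connected components of the underlying graph. *)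

(* Defs.v *)
From HB Require Import structures.
From mathcomp Require Import all_boot.
From mathcomp Require Import boolp.

Set Implicit Arguments.
Unset Strict Implicit.
Unset Printing Implicit Defensive.
Set Warnings "-redundant-canonical-projection".

Local Open Scope quotient_scope.

Section Words.
Variable X : choiceType.

(* The letter (x, false) stands for x and (x, true) for x^-1; words need not
   be reduced. *)
Definition word := seq (X * bool).

Definition linv (a : X * bool) : X * bool := (a.1, ~~ a.2).
Definition winv (w : word) : word := rev (map linv w).
Definition wgen (x : X) : word := [:: (x, false)].

End Words.

(* The presentation < pgen | prel i (i : pidx) >. *)
Record presentation := Presentation {
  pgen : choiceType;
  pidx : Type;
  prel : pidx -> word pgen }.

Section PresentedGroup.
Variable P : presentation.

(* The least congruence on words for which letters cancel and every relator
   is trivial, i.e. equality modulo the normal closure of the relators. *)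
Inductive pres_eq : word (pgen P) -> word (pgen P) -> Prop :=
| pres_eq_refl u : pres_eq u u
| pres_eq_sym u v : pres_eq u v -> pres_eq v u
| pres_eq_trans u v w : pres_eq u v -> pres_eq v w -> pres_eq u w
| pres_eq_cat u u' v v' :
    pres_eq u u' -> pres_eq v v' -> pres_eq (u ++ v) (u' ++ v')
| pres_eq_cancel a : pres_eq [:: a; linv a] [::]
| pres_eq_rel i : pres_eq (prel i) [::].

Definition pres_eqb (u v : word (pgen P)) : bool := `[< pres_eq u v >].

Lemma pres_eqb_refl : reflexive pres_eqb.
Proof. by move=> u; apply/asboolP; exact: pres_eq_refl. Qed.

Lemma pres_eqb_sym : symmetric pres_eqb.
Proof.
by move=> u v; apply/idP/idP => /asboolP h; apply/asboolP; exact: pres_eq_sym.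
Qed.

Lemma pres_eqb_trans : transitive pres_eqb.
Proof.
move=> v u w /asboolP uv /asboolP vw; apply/asboolP.
exact: pres_eq_trans uv vw.
Qed.

Canonical pres_eqb_equiv :=
  EquivRel pres_eqb pres_eqb_refl pres_eqb_sym pres_eqb_trans.

Definition presented_group := {eq_quot pres_eqb}.

HB.instance Definition _ := Choice.on presented_group.
HB.instance Definition _ := EqQuotient.on presented_group.

Lemma pi_presP (u v : word (pgen P)) :
  \pi_presented_group u = \pi_presented_group v <-> pres_eq u v.
Proof.
split=> [/eqP | h]; first by rewrite eqmodE => /asboolP.
by apply/eqP; rewrite eqmodE; apply/asboolP.
Qed.

Lemma winv_cat (u v : word (pgen P)) : winv (u ++ v) = winv v ++ winv u.
Proof. by rewrite /winv map_cat rev_cat. Qed.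

Lemma linvK : involutive (@linv (pgen P)).
Proof. by case=> x b; rewrite /linv /= negbK. Qed.

Lemma winvK : involutive (@winv (pgen P)).
Proof.
by move=> u; rewrite /winv map_rev revK -map_comp (eq_map linvK) map_id.
Qed.

Lemma pres_eq_mulV (u : word (pgen P)) : pres_eq (u ++ winv u) [::].
Proof.
elim: u => [|a u IHu]; first exact: pres_eq_refl.
have -> : (a :: u) ++ winv (a :: u) = [:: a] ++ ((u ++ winv u) ++ [:: linv a]).
  by rewrite -cat1s winv_cat !catA.
apply: pres_eq_trans (pres_eq_cancel a).
apply: (pres_eq_cat (pres_eq_refl [:: a])).
exact: pres_eq_cat IHu (pres_eq_refl [:: linv a]).
Qed.

Lemma pres_eq_mulVl (u : word (pgen P)) : pres_eq (winv u ++ u) [::].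
Proof. by have := pres_eq_mulV (winv u); rewrite winvK. Qed.

Lemma pres_eq_winv (u v : word (pgen P)) :
  pres_eq u v -> pres_eq (winv u) (winv v).
Proof.
move=> uv; apply: (@pres_eq_trans _ (winv u ++ (v ++ winv v))).
  rewrite -[X in pres_eq X _]cats0; apply: pres_eq_cat; first exact: pres_eq_refl.
  exact/pres_eq_sym/pres_eq_mulV.
rewrite catA -[X in pres_eq _ X]cat0s.
apply: pres_eq_cat; last exact: pres_eq_refl.
apply: pres_eq_trans (pres_eq_mulVl u).
exact: pres_eq_cat (pres_eq_refl _) (pres_eq_sym uv).
Qed.

Definition pres_one : presented_group := \pi_presented_group [::].
Definition pres_mul (x y : presented_group) : presented_group :=
  \pi_presented_group (repr x ++ repr y).
Definition pres_inv (x : presented_group) : presented_group :=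
  \pi_presented_group (winv (repr x)).

Lemma pres_eq_repr (u : word (pgen P)) :
  pres_eq (repr (\pi_presented_group u)) u.
Proof. by apply/pi_presP; rewrite reprK. Qed.

Lemma pi_pres_mul (u v : word (pgen P)) :
  pres_mul (\pi_presented_group u) (\pi_presented_group v)
  = \pi_presented_group (u ++ v).
Proof. by apply/pi_presP; apply: pres_eq_cat; apply: pres_eq_repr. Qed.

Lemma pi_pres_inv (u : word (pgen P)) :
  pres_inv (\pi_presented_group u) = \pi_presented_group (winv u).
Proof. by apply/pi_presP; apply: pres_eq_winv; apply: pres_eq_repr. Qed.

Lemma pres_mulA : associative pres_mul.
Proof.
move=> x y z; elim/quotW: x => u; elim/quotW: y => v; elim/quotW: z => w.
by rewrite (pi_pres_mul v w) (pi_pres_mul u v) (pi_pres_mul u) (pi_pres_mul _ w)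
  catA.
Qed.

Lemma pres_mul1g : left_id pres_one pres_mul.
Proof. by elim/quotW=> u; exact: pi_pres_mul [::] u. Qed.

Lemma pres_mulg1 : right_id pres_one pres_mul.
Proof. by elim/quotW=> u; rewrite /pres_one pi_pres_mul cats0. Qed.

Lemma pres_mulVg : left_inverse pres_one pres_inv pres_mul.
Proof.
elim/quotW=> u; rewrite pi_pres_inv pi_pres_mul.
exact/pi_presP/pres_eq_mulVl.
Qed.

Lemma pres_mulgV : right_inverse pres_one pres_inv pres_mul.
Proof.
elim/quotW=> u; rewrite pi_pres_inv pi_pres_mul.
exact/pi_presP/pres_eq_mulV.
Qed.

HB.instance Definition _ := isGroup.Build presented_group
  pres_mulA pres_mul1g pres_mulg1 pres_mulVg pres_mulgV.

End PresentedGroup.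

Definition isomorphic (G H : groupType) : Prop :=
  exists f : {multiplicative G -> H}, bijective f.

Definition has_presentation (G : groupType) (P : presentation) : Prop :=
  isomorphic G (presented_group P).

(* ordS is the successor modulo n on 'I_n. *)
Definition sieradski_presentation (n : nat) : presentation :=
  @Presentation 'I_n 'I_n (fun i =>
    wgen i ++ wgen (ordS (ordS i)) ++ winv (wgen (ordS i))).

Definition sieradski (n : nat) : groupType :=
  presented_group (sieradski_presentation n).

Record LOG := MkLOG {
  log_vertex : finType;
  log_edge : finType;
  log_init : log_edge -> log_vertex;
  log_term : log_edge -> log_vertex;
  log_label : log_edge -> log_vertex }.

Definition LOG_presentation (L : LOG) : presentation :=
  @Presentation (log_vertex L) (log_edge L) (fun e =>
    winv (wgen (log_term e)) ++ winv (wgen (log_label e)) ++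
    wgen (log_init e) ++ wgen (log_label e)).

Definition is_LOG_group (G : groupType) : Prop :=
  exists L : LOG, has_presentation G (LOG_presentation L).

Definition log_adj (L : LOG) : rel (log_vertex L) := fun u v =>
  [exists e : log_edge L,
     ((log_init e == u) && (log_term e == v)) ||
     ((log_init e == v) && (log_term e == u))].

Definition LOG_components (L : LOG) : nat :=
  n_comp (@log_adj L) (log_vertex L).

(* The LOG given by a family of relations t = l^-1 i l, encoded as (t, l, i). *)
Definition LOG_of_relations (V E : finType) (r : E -> V * V * V) : LOG :=
  @MkLOG V E (fun e => (r e).2) (fun e => (r e).1.1) (fun e => (r e).1.2).

Section SieradskiLOG.
Variable l : nat.

Lemma double_ord_subproof (j : 'I_l) : 2 * j < 2 * l.
Proof. by rewrite ltn_pmul2l. Qed.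

Definition double_ord (j : 'I_l) : 'I_(2 * l) :=
  Ordinal (double_ord_subproof j).

Definition sieradski_vertex : finType := ('I_(2 * l) + 'I_(2 * l))%type.

Definition va (k : 'I_(2 * l)) : sieradski_vertex := inl k.
Definition vb (k : 'I_(2 * l)) : sieradski_vertex := inr k.

(* One summand for each of the four relations attached to j; the indices
   2j, 2j+1, 2j+2 below are taken modulo 2l. *)
Definition sieradski_edge : finType := ('I_l + 'I_l + ('I_l + 'I_l))%type.

Definition sieradski_relation (e : sieradski_edge) :
    sieradski_vertex * sieradski_vertex * sieradski_vertex :=
  let j0 j := double_ord j in
  let j1 j := ordS (j0 j) in
  let j2 j := ordS (j1 j) in
  match e with
  | inl (inl j) => (va (j1 j), vb (j0 j), va (j0 j))
  | inl (inr j) => (va (j1 j), vb (j1 j), va (j2 j))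
  | inr (inl j) => (vb (j0 j), va (j1 j), vb (j1 j))
  | inr (inr j) => (vb (j2 j), va (j2 j), vb (j1 j))
  end.

Definition sieradski_LOG : LOG := LOG_of_relations sieradski_relation.

End SieradskiLOG.

(* Main.v *)
(** Put [A_k = x_{3k}] and [B_k = x_{3k+1}].  The relations
    [x_i x_{i+2} = x_{i+1}] say that [x_{3k+2} = A_k^-1 B_k] and that
    [A_{k+1} = B_k^-1 A_k^-1 B_k], [B_{k+1} = A_{k+1}^-1 B_k^-1 A_{k+1}].
    The inversions are absorbed by setting [a_k = A_k^{(-1)^k}] and
    [b_k = B_k^{(-1)^k}], which is consistent because [k] ranges modulo the
    even number [2l]; the result is the LOG presentation.  Every edge of the
    LOG joins two [a]'s or two [b]'s with consecutive indices, whence the two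
    components. *)

Require Import Defs.
From mathcomp Require Import all_boot.
From HB Require Import structures.

Set Implicit Arguments.
Unset Strict Implicit.
Unset Printing Implicit Defensive.

Local Open Scope quotient_scope.
Local Open Scope group_scope.

(** The boolean is a sign in two roles: the exponent of a letter in a word, and, as [odd k], the
    exponent $(-1)^k$. *)
Definition signed_pow (G : groupType) (x : G) (b : bool) : G :=
  if b then x^-1 else x.

Lemma signed_powK (G : groupType) (x : G) (b : bool) :
  signed_pow (signed_pow x b) b = x.
Proof. by case: b => //=; rewrite invgK. Qed.

Lemma signed_pow_morph (G H : groupType) (f : UMagmaMorphism.type G H) x b :
  f (signed_pow x b) = signed_pow (f x) b.
Proof. by case: b => //=; rewrite gmulfV. Qed.

Lemma mul_signed_powV (G : groupType) (x : G) (b : bool) :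
  signed_pow x b * signed_pow x (~~ b) = 1.
Proof. by case: b; rewrite /= ?mulVg ?mulgV. Qed.

(** * The universal property of a presented group *)

Definition word_eval (X : choiceType) (G : groupType) (f : X -> G)
    (w : word X) : G :=
  foldr (fun a z => signed_pow (f a.1) a.2 * z) 1 w.

Lemma word_eval_cat (X : choiceType) (G : groupType) (f : X -> G) u v :
  word_eval f (u ++ v) = word_eval f u * word_eval f v.
Proof. by elim: u => [|a u IHu] /=; rewrite ?mul1g // IHu mulgA. Qed.

Section Lift.
Variables (P : presentation) (G : groupType) (f : pgen P -> G).
Hypothesis f_rel : forall i, word_eval f (prel i) = 1.

Lemma word_eval_pres_eq u v : pres_eq u v -> word_eval f u = word_eval f v.
Proof.
elim=> //= {u v} [u v w _ -> //|u u' v v' _ IHu _ IHv|a].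
  by rewrite !word_eval_cat IHu IHv.
by rewrite mulg1 mul_signed_powV.
Qed.

(** The choice of representative is harmless, since [word_eval_pres_eq] makes evaluation constant on
    classes. *)
Definition pres_lift (x : presented_group P) : G := word_eval f (repr x).

Lemma pres_lift_pi w : pres_lift (\pi w) = word_eval f w.
Proof. exact/word_eval_pres_eq/pres_eq_repr. Qed.

Lemma pres_liftM : {morph pres_lift : x y / x * y}.
Proof. by move=> x y; rewrite [x * y]/(pres_mul x y) pres_lift_pi word_eval_cat. Qed.

Lemma pres_lift1 : pres_lift 1 = 1.
Proof. exact: (pres_lift_pi [::]). Qed.

HB.instance Definition _ :=
  isUMagmaMorphism.Build (presented_group P) G pres_lift (pres_lift1, pres_liftM).

Definition pres_lift_morphism : UMagmaMorphism.type (presented_group P) G :=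
  pres_lift.

End Lift.

Section Generators.
Variable P : presentation.

Definition pres_gen (x : pgen P) : presented_group P :=
  \pi_(presented_group P) (wgen x).

Lemma pi_word_eval (w : word (pgen P)) :
  \pi_(presented_group P) w = word_eval pres_gen w.
Proof.
elim: w => [|[x b] w IHw] //=; rewrite -IHw -cat1s -pi_pres_mul.
congr (pres_mul _ _); case: b => //.
by rewrite /= [LHS](_ : _ = pres_inv (pres_gen x)) // pi_pres_inv.
Qed.

Lemma pres_gen_rel i : word_eval pres_gen (prel i) = 1.
Proof. by rewrite -pi_word_eval; apply/pi_presP/pres_eq_rel. Qed.

Lemma pres_lift_gen (G : groupType) (f : pgen P -> G) f_rel x :
  @pres_lift_morphism P G f f_rel (pres_gen x) = f x.
Proof. by rewrite /= pres_lift_pi //= mulg1. Qed.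

(** Every class is a product of generators and their inverses, by [pi_word_eval]. *)
Lemma pres_morph_id (h : UMagmaMorphism.type (presented_group P) (presented_group P)) :
  (forall x, h (pres_gen x) = pres_gen x) -> h =1 id.
Proof.
move=> h_gen; elim/quotW=> w; rewrite pi_word_eval.
elim: w => [|[x b] w IHw] /=; first exact: gmulf1.
by rewrite gmulfM IHw signed_pow_morph h_gen.
Qed.

End Generators.

Lemma pres_isomorphic (P Q : presentation)
    (f : UMagmaMorphism.type (presented_group P) (presented_group Q))
    (g : UMagmaMorphism.type (presented_group Q) (presented_group P)) :
  (forall x, g (f (pres_gen x)) = pres_gen x) ->
  (forall y, f (g (pres_gen y)) = pres_gen y) ->
  isomorphic (presented_group P) (presented_group Q).
Proof.
move=> gf fg; exists f; exists g => x.
  exact: (@pres_morph_id P (g \o f)).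
exact: (@pres_morph_id Q (f \o g)).
Qed.

Lemma LOG_eval_eq1 (L : LOG) (G : groupType) (f : log_vertex L -> G)
    (e : log_edge L) :
  word_eval f (@prel (LOG_presentation L) e) = 1 <->
  f (log_term e) = f (log_init e) ^ f (log_label e).
Proof.
rewrite /= mulg1 -conjgE; split=> [/mulg1_eq|->]; last exact: mulVg.
by rewrite invgK.
Qed.

(** * Sequences with [x_i x_(i+2) = x_(i+1)] *)

Section Sequences.
Variable G : groupType.

(** Expanding $x_{i+3} = x_{i+1}^{-1}x_{i+2}$ with $x_{i+2} = x_i^{-1}x_{i+1}$ gives the first form;
    with $x_{i+1} = x_i x_{i+2}$, the second. They serve at $i = 3k$ and $i = 3k+1$ respectively. *)
Lemma sieradski_conj (x : nat -> G) :
    (forall i, x i * x i.+2 = x i.+1) ->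
  forall i, x i.+3 = (x i)^-1 ^ x i.+1 /\ x i.+3 = (x i)^-1 ^ x i.+2.
Proof.
move=> x_rel i; have x2 j : x j.+2 = (x j)^-1 * x j.+1 by rewrite -(x_rel j) mulKg.
by rewrite !conjgE -(x2 i) (x2 i.+1); split; rewrite // -(x_rel i) invgM mulgA.
Qed.

(** Rebuilds the sequence $x$ from its terms at $3k$ and $3k+1$; the relation at $3k$ forces the
    term at $3k+2$. *)
Definition interleave (A B : nat -> G) (m : nat) : G :=
  match m %% 3 with
  | 0 => A (m %/ 3)
  | 1 => B (m %/ 3)
  | _ => (A (m %/ 3))^-1 * B (m %/ 3)
  end.

Lemma interleave0 A B k : interleave A B (3 * k) = A k.
Proof. by rewrite /interleave mulnC modnMl mulnK. Qed.

Lemma interleave1 A B k : interleave A B (3 * k).+1 = B k.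
Proof. by rewrite /interleave mulnC -addn1 modnMDl divnMDl // addn0. Qed.

Lemma interleave2 A B k : interleave A B (3 * k).+2 = (A k)^-1 * B k.
Proof. by rewrite /interleave mulnC -addn2 modnMDl divnMDl // addn0. Qed.

Lemma nat3P (m : nat) :
  exists k, [\/ m = 3 * k, m = (3 * k).+1 | m = (3 * k).+2]%N.
Proof.
exists (m %/ 3); rewrite {1 3 5}(divn_eq m 3) mulnC.
case: (m %% 3) (ltn_pmod m (isT : 0 < 3)) => [|[|[|//]]] _.
- by rewrite addn0; constructor 1.
- by rewrite addn1; constructor 2.
- by rewrite addn2; constructor 3.
Qed.

Lemma interleave_sieradski (A B : nat -> G) :
    (forall k, A k.+1 = (A k)^-1 ^ B k) ->
    (forall k, B k.+1 = (B k)^-1 ^ A k.+1) ->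
  forall m, interleave A B m * interleave A B m.+2 = interleave A B m.+1.
Proof.
move=> A_rel B_rel m.
have S3 k : (3 * k).+3 = (3 * k.+1)%N by rewrite mulnS.
(* This is the relation at $3k+1$; it also rewrites the term at $3k+2$ so that the last case
   cancels. *)
have BA k : B k * A k.+1 = (A k)^-1 * B k by rewrite A_rel conjgE mulVKg.
have [k [->|->|->]] := nat3P m; rewrite ?S3 !(interleave0, interleave1, interleave2).
- by rewrite mulVKg.
- exact: BA.
- by rewrite B_rel conjgE -BA mulgA mulgK mulVKg.
Qed.

(** Reduction modulo $3n$ keeps the residue modulo 3 and reduces the quotient by 3 modulo $n$. *)
Lemma interleave_modn (A B : nat -> G) (n : nat) :
    (forall k, A (k %% n) = A k) -> (forall k, B (k %% n) = B k) ->
  forall m, interleave A B (m %% (3 * n)) = interleave A B m.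
Proof.
move=> A_mod B_mod m; rewrite /interleave modn_dvdm ?dvdn_mulr //.
by rewrite mulnC -modn_divl A_mod B_mod.
Qed.

End Sequences.

Lemma interleave_morph (G H : groupType) (f : UMagmaMorphism.type G H)
    (A B : nat -> G) m :
  f (interleave A B m) = interleave (f \o A) (f \o B) m.
Proof. by rewrite /interleave; case: (m %% 3) => [|[|r]] //=; rewrite gmulfM gmulfV. Qed.

Local Close Scope group_scope.

(** * The isomorphism *)

(** Turns families indexed by ['I_n] into periodic sequences on [nat], where [ordS] becomes the
    plain successor. *)
Definition mod_ord (n : nat) (n_gt0 : 0 < n) (m : nat) : 'I_n :=
  Ordinal (ltn_pmod m n_gt0).

Lemma mod_ord_modn n (n_gt0 : 0 < n) m : mod_ord n_gt0 (m %% n) = mod_ord n_gt0 m.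
Proof. by apply: val_inj; rewrite /= modn_mod. Qed.

Lemma mod_ord_val n (n_gt0 : 0 < n) (i : 'I_n) : mod_ord n_gt0 i = i.
Proof. by apply: val_inj; rewrite /= modn_small. Qed.

Lemma ordS_mod_ord n (n_gt0 : 0 < n) m :
  ordS (mod_ord n_gt0 m) = mod_ord n_gt0 m.+1.
Proof. by apply: val_inj; rewrite /= -addn1 modnDml addn1. Qed.

Lemma double_mod_ord l (l_gt0 : 0 < l) (l2_gt0 : 0 < 2 * l) j :
  double_ord (mod_ord l_gt0 j) = mod_ord l2_gt0 (2 * j).
Proof. by apply: val_inj; rewrite /= muln_modr. Qed.

Section Isomorphism.
Variables (l : nat) (l_gt0 : 0 < l).

Let l2_gt0 : 0 < 2 * l. Proof. by rewrite muln_gt0. Qed.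
Let l6_gt0 : 0 < 6 * l. Proof. by rewrite muln_gt0. Qed.
Let mul32 : 3 * (2 * l) = 6 * l. Proof. by rewrite mulnA. Qed.

Let S : presentation := sieradski_presentation (6 * l).
Let T : presentation := LOG_presentation (sieradski_LOG l).

(** The modulus is even, so the sign $(-1)^k$ descends to residues. *)
Let odd_mod2 k : odd (k %% (2 * l)) = odd k.
Proof. by rewrite {2}(divn_eq k (2 * l)) oddD !oddM andbF. Qed.

(** * From the Sieradski group to the LOG group *)

Let a k : presented_group T := @pres_gen T (va (mod_ord l2_gt0 k)).
Let b k : presented_group T := @pres_gen T (vb (mod_ord l2_gt0 k)).

Let LOG_rel (e : sieradski_edge l) :=
  let: (t, lab, i) := sieradski_relation e in
  @pres_gen T t = (@pres_gen T i ^ @pres_gen T lab)%g.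

Let LOG_relP e : LOG_rel e.
Proof.
rewrite /LOG_rel.
have /(@LOG_eval_eq1 (sieradski_LOG l)) := @pres_gen_rel T e.
by rewrite /=; case: sieradski_relation => [[]].
Qed.

Let ab_rel j :
  [/\ a (2 * j).+1 = (a (2 * j) ^ b (2 * j))%g,
      a (2 * j).+1 = (a (2 * j).+2 ^ b (2 * j).+1)%g,
      b (2 * j) = (b (2 * j).+1 ^ a (2 * j).+1)%g
    & b (2 * j).+2 = (b (2 * j).+1 ^ a (2 * j).+2)%g].
Proof.
set i := mod_ord l_gt0 j.
split; rewrite /a /b -?ordS_mod_ord -(double_mod_ord l_gt0).
- exact: (LOG_relP (inl (inl i))).
- exact: (LOG_relP (inl (inr i))).
- exact: (LOG_relP (inr (inl i))).
- exact: (LOG_relP (inr (inr i))).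
Qed.

Let A k := signed_pow (a k) (odd k).
Let B k := signed_pow (b k) (odd k).

Let nat2P k : exists j, k = 2 * j \/ k = (2 * j).+1.
Proof.
exists k./2; rewrite mul2n -{1 3}(odd_double_half k).
by case: (odd k); [right|left].
Qed.

(** For even $k$ this is the first LOG relation inverted; for odd $k$, the second solved for
    $a_{2j+2}$. *)
Let A_rel k : A k.+1 = ((A k)^-1 ^ B k)%g.
Proof.
have [j [->|->]] := nat2P k; have [r1 r2 _ _] := ab_rel j;
  rewrite /A /B /= mul2n odd_double /= -mul2n.
  by rewrite r1 conjVg.
by rewrite invgK r2 conjgK.
Qed.

(** Even $k$ uses the third LOG relation, odd $k$ the fourth. *)
Let B_rel k : B k.+1 = ((B k)^-1 ^ A k.+1)%g.
Proof.
have [j [->|->]] := nat2P k; have [_ _ r3 r4] := ab_rel j;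
  rewrite /A /B /= mul2n odd_double /= -mul2n.
  by rewrite r3 -conjVg conjgK.
by rewrite invgK r4.
Qed.

Let a_mod k : a (k %% (2 * l)) = a k.
Proof. by rewrite /a mod_ord_modn. Qed.

Let b_mod k : b (k %% (2 * l)) = b k.
Proof. by rewrite /b mod_ord_modn. Qed.

Let AB_mod m : interleave A B (m %% (6 * l)) = interleave A B m.
Proof.
by rewrite -mul32; apply: interleave_modn => k; rewrite /A /B odd_mod2 ?a_mod ?b_mod.
Qed.

Let to_LOG_gen (i : 'I_(6 * l)) : presented_group T := interleave A B i.

Let to_LOG_rel i : word_eval to_LOG_gen (@prel S i) = 1%g.
Proof.
rewrite /= mulg1 /to_LOG_gen -[i](mod_ord_val l6_gt0) !ordS_mod_ord /= !AB_mod mulgA.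
by rewrite interleave_sieradski // mulgV.
Qed.

Let to_LOG := pres_lift_morphism to_LOG_rel.

(** * From the LOG group to the Sieradski group *)

Let x m : presented_group S := @pres_gen S (mod_ord l6_gt0 m).

Let x_rel m : (x m * x m.+2)%g = x m.+1.
Proof.
have := @pres_gen_rel S (mod_ord l6_gt0 m).
by rewrite /= mulg1 !ordS_mod_ord mulgA => /divg1_eq.
Qed.

Let x_mod m : x (m %% (6 * l)) = x m.
Proof. by rewrite /x mod_ord_modn. Qed.

Let xa k := signed_pow (x (3 * k)) (odd k).
Let xb k := signed_pow (x (3 * k).+1) (odd k).

Let xa_mod k : xa (k %% (2 * l)) = xa k.
Proof. by rewrite /xa odd_mod2 muln_modr mul32 x_mod. Qed.

Let xb_mod k : xb (k %% (2 * l)) = xb k.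
Proof.
rewrite /xb odd_mod2 muln_modr mul32; congr (signed_pow _ _).
by rewrite -x_mod -addn1 modnDml addn1 x_mod.
Qed.

Let xab_rel j :
  [/\ xa (2 * j).+1 = (xa (2 * j) ^ xb (2 * j))%g,
      xa (2 * j).+1 = (xa (2 * j).+2 ^ xb (2 * j).+1)%g,
      xb (2 * j) = (xb (2 * j).+1 ^ xa (2 * j).+1)%g
    & xb (2 * j).+2 = (xb (2 * j).+1 ^ xa (2 * j).+2)%g].
Proof.
have S3 k : 3 * k.+1 = (3 * k).+3 by rewrite mulnS.
have x3 k := (sieradski_conj x_rel (3 * k)).1.
have x4 k := (sieradski_conj x_rel (3 * k).+1).2.
rewrite /xa /xb /= mul2n odd_double /= -mul2n !S3; split.
- by rewrite x3 conjVg invgK.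
(* Refolding [(3 * (2 * j)).+3] as [3 * (2 * j).+1] lets [x3] apply at the odd index $2j+1$. *)
- by rewrite -S3 x3 S3 conjgK.
- by rewrite x4 -conjVg invgK conjgK.
- by rewrite -S3 x4 S3.
Qed.

Let of_LOG_gen (v : sieradski_vertex l) : presented_group S :=
  match v with inl k => xa k | inr k => xb k end.

Let of_LOG_rel e : word_eval of_LOG_gen (@prel T e) = 1%g.
Proof.
have mod2 k : ((k %% (2 * l)).+1 = k.+1 %[mod 2 * l])%N.
  by rewrite -addn1 modnDml addn1.
apply/(@LOG_eval_eq1 (sieradski_LOG l)).
by case: e => [] [] j; have [r1 r2 r3 r4] := xab_rel j;
  rewrite /= ?mod2 ?xa_mod ?xb_mod.
Qed.

Let of_LOG := pres_lift_morphism of_LOG_rel.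

Let of_LOG_a k : of_LOG (a k) = xa k.
Proof. by rewrite /of_LOG pres_lift_gen /= xa_mod. Qed.

Let of_LOG_b k : of_LOG (b k) = xb k.
Proof. by rewrite /of_LOG pres_lift_gen /= xb_mod. Qed.

(** * The two maps are mutually inverse *)

Let to_LOG_x m : to_LOG (x m) = interleave A B m.
Proof. by rewrite /to_LOG pres_lift_gen /to_LOG_gen /= AB_mod. Qed.

Let to_LOGK m : of_LOG (to_LOG (x m)) = x m.
Proof.
rewrite to_LOG_x interleave_morph.
(* The sign in [A] and the one in [xa] have the same parity, so they cancel. *)
have oA k : (of_LOG \o A) k = x (3 * k).
  by rewrite [LHS]signed_pow_morph of_LOG_a signed_powK.
have oB k : (of_LOG \o B) k = x (3 * k).+1.
  by rewrite [LHS]signed_pow_morph of_LOG_b signed_powK.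
have [k [->|->|->]] := nat3P m; rewrite !(interleave0, interleave1, interleave2).
- exact: oA.
- exact: oB.
- by rewrite oA oB -x_rel mulKg.
Qed.

Lemma sieradski_LOG_isomorphic :
  isomorphic (presented_group S) (presented_group T).
Proof.
apply: (@pres_isomorphic S T to_LOG of_LOG) => [i|v].
  by rewrite -[i](mod_ord_val l6_gt0) to_LOGK.
case: v => k; rewrite -[k](mod_ord_val l2_gt0).
  by rewrite -/(a k) of_LOG_a signed_pow_morph to_LOG_x interleave0 signed_powK.
by rewrite -/(b k) of_LOG_b signed_pow_morph to_LOG_x interleave1 signed_powK.
Qed.

End Isomorphism.

(** * Components *)

Section Components.
Variables (l : nat) (l_gt0 : 0 < l).

Let l2_gt0 : 0 < 2 * l. Proof. by rewrite muln_gt0. Qed.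
Let adj := @log_adj (sieradski_LOG l).

Let adj_sym : symmetric adj.
Proof. by move=> u v; apply: eq_existsb => e; rewrite orbC. Qed.

Let conn_sym : connect_sym adj.
Proof. exact: sym_connect_sym. Qed.

Let edge_adj (e : sieradski_edge l) :
  adj (sieradski_relation e).2 (sieradski_relation e).1.1.
Proof. by apply/existsP; exists e; rewrite !eqxx. Qed.

(** Links leaving even and odd indices are separate hypotheses because they come from different
    kinds of edges; the induction follows the parity of the index. *)
Let step (s : 'I_(2 * l) -> sieradski_vertex l) :
    (forall j, connect adj (s (double_ord j)) (s (ordS (double_ord j)))) ->
    (forall j, connect adj (s (ordS (double_ord j)))
                           (s (ordS (ordS (double_ord j))))) ->
  forall k, connect adj (s (mod_ord l2_gt0 0)) (s k).
Proof.
move=> s0 s1 k; rewrite -[k](mod_ord_val l2_gt0).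
elim: (k : nat) => [|m IHm]; first exact: connect0.
apply: connect_trans IHm _; rewrite -ordS_mod_ord.
rewrite -(odd_double_half m) -mul2n; case: (odd m).
  by rewrite add1n -ordS_mod_ord -(double_mod_ord l_gt0); exact: s1.
by rewrite add0n -(double_mod_ord l_gt0); exact: s0.
Qed.

(** An invariant of connectivity, used to keep the two components apart. *)
Let is_a (v : sieradski_vertex l) := if v is inl _ then true else false.

Let adj_is_a u v : adj u v -> is_a u = is_a v.
Proof.
case/existsP=> e /orP[] /andP[] /eqP<- /eqP<-;
  by case: e => [] [] j.
Qed.

Let conn_is_a u v : connect adj u v -> is_a u = is_a v.
Proof.
case/connectP=> p; elim: p u => [|w p IHp] u /=; first by move=> _ ->.
by case/andP=> /adj_is_a -> /IHp wp /wp.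
Qed.

Lemma sieradski_LOG_components : LOG_components (sieradski_LOG l) = 2.
Proof.
have conn_a k : connect adj (va (mod_ord l2_gt0 0)) (va k).
  apply: step => j; first exact: connect1 (edge_adj (inl (inl j))).
  (* This edge runs from index $2j+2$ down to $2j+1$, hence the appeal to symmetry. *)
  by rewrite conn_sym; exact: connect1 (edge_adj (inl (inr j))).
have conn_b k : connect adj (vb (mod_ord l2_gt0 0)) (vb k).
  apply: step => j; last exact: connect1 (edge_adj (inr (inr j))).
  by rewrite conn_sym; exact: connect1 (edge_adj (inr (inl j))).
set ca := connect adj (va (mod_ord l2_gt0 0)) in conn_a.
(* The complement of the class of $a_0$ is exactly the class of $b_0$, so each part contributes one
   component. *)
have compl_ca : n_comp adj [predC ca] = 1.
  rewrite -(n_comp_connect conn_sym (vb (mod_ord l2_gt0 0))).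
  apply: eq_n_comp_r => v; rewrite -[LHS]/(~~ ca v) -[RHS]/(connect _ _ _).
  case: v => k.
    by rewrite conn_a; apply/esym/negP => /conn_is_a.
  by rewrite conn_b; apply/negP => /conn_is_a.
by rewrite /LOG_components (n_compC ca) (n_comp_connect conn_sym) compl_ca.
Qed.

End Components.

Theorem theorem5p1 (l : nat) (hl : 1 <= l) :
  [/\ is_LOG_group (sieradski (6 * l)),
      has_presentation (sieradski (6 * l)) (LOG_presentation (sieradski_LOG l))
    & LOG_components (sieradski_LOG l) = 2].
Proof.
have iso := sieradski_LOG_isomorphic hl.
by split=> //; [exists (sieradski_LOG l) | exact: sieradski_LOG_components].
Qed.
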